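(* (a) If $w$ is a word of length $n$ over the alphabet $\{a,b\}$ with $|w|_a=3$, then $w$ contains at least $$\left\lfloor \frac{\lceil \frac{n-3}{2}\rceil}{2}\right\rfloor+1=\left\lfloor \frac{\lceil \frac{n+1}{2}\rceil}{2}\right\rfloor=\left\lfloor \frac{n+2}{4}\right\rfloor$$ abelian squares. This bound is achieved by $b^{\lfloor (n-3)/2\rfloor}a^3b^{\lceil (n-3)/2\rceil}$. (b) The bound is also achieved by other words. The full set of words $w$ of length $n$ with $|w|_a=3$ achieving the bound is as follows: - if $n\equiv 0 \pmod 4$, then $w=b^{(n-4)/2}a^3b^{(n-2)/2}$ or its reverse; - if $n\equiv 1 \pmod 4$, then $w=b^{(n-3)/2}a^3b^{(n-3)/2}$; - if $n\equiv 2 \pmod 4$, then $w=b^{(n-6)/2}a^3b^{n/2}$, or $w=b^{(n-2)/2}a^3b^{(n-4)/2}$, or $w$ is the reverse of one of these; - if $n\equiv 3 \pmod 4$, then $w=b^{(n-3)/2}a^3b^{(n-3)/2}$, or $w=b^{(n-1)/2}a^3b^{(n-5)/2}$ or its reverse.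
   Context: Words are over the alphabet $\{a,b\}$. For a word $u$, $|u|$ is its length, $|u|_a$ and $|u|_b$ are the numbers of $a$'s and $b$'s in $u$, and its Parikh vector is $\mathcal{P}(u)=[|u|_a,|u|_b]$. A factor of a word is a contiguous subword. An abelian square is a word $uv$ with $|u|=|v|\ge 1$ and $\mathcal{P}(u)=\mathcal{P}(v)$. The number of abelian squares in a word $w$ is the number of distinct words that are abelian squares and occur as factors of $w$. The reverse of a word is the word written backwards.
   Formalization: Part (b) is false as printed for n = 4, 6, 7; for these n the set of words achieving the bound is the listed words plus abaa, aaba (n=4), abbbaa, aabbba, ababab, bababa (n=6), bababab (n=7); for all other n it is as printed. *)

(* Defs.v *)
From mathcomp Require Import all_boot.

Set Implicit Arguments.
Unset Strict Implicit.
Unset Printing Implicit Defensive.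

(* The alphabet {a, b} is the two-element type bool. *)
Definition letter := bool.
Definition La : letter := true.
Definition Lb : letter := false.

Definition word := seq letter.

Definition num_a (u : word) : nat := count_mem La u.
Definition num_b (u : word) : nat := count_mem Lb u.

Definition parikh (u : word) : nat * nat := (num_a u, num_b u).

(* The halves range over the finite type of words of length at most |x|, so
   that the predicate is boolean; see abelian_squareP for the unbounded form. *)
Definition abelian_square (x : word) : bool :=
  [exists u : (size x).-bseq bool, exists v : (size x).-bseq bool,
    [&& x == u ++ v, size u == size v, 1 <= size u & parikh u == parikh v]].

Lemma abelian_squareP (x : word) :
  reflect (exists u v : word,
             [/\ x = u ++ v, size u = size v, 1 <= size u
               & parikh u = parikh v])
          (abelian_square x).
Proof.
apply: (iffP existsP) => [[u /existsP[v]]|[u [v [xE suv u0 puv]]]].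
  by case/and4P=> /eqP xE /eqP suv u0 /eqP puv; exists u, v.
have su : size u <= size x by rewrite xE size_cat leq_addr.
have sv : size v <= size x by rewrite xE size_cat leq_addl.
exists (Bseq su); apply/existsP; exists (Bseq sv).
by apply/and4P; split=> //=; apply/eqP.
Qed.

(* Number of distinct words that are abelian squares and factors of w; a
   factor of w has length at most |w|, hence the bounded-sequence type. *)
Definition num_abelian_squares (w : word) : nat :=
  #|[set x : (size w).-bseq bool | infix x w && abelian_square x]|.

(* b^i a^3 b^j *)
Definition baaab (i j : nat) : word := nseq i Lb ++ nseq 3 La ++ nseq j Lb.

(* The words of length n >= 3 in the family of extremal words, according to
   n mod 4.  All subtractions are exact for n >= 3, except n - 5 at n = 3: there
   the word b^((n-1)/2) a^3 b^((n-5)/2) does not exist, and its truncated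
   version has length 4, so it is never equal to a word of length n. *)
Definition extremal_words (n : nat) : seq word :=
  match n %% 4 with
  | 0 => let w := baaab ((n - 4) %/ 2) ((n - 2) %/ 2) in [:: w; rev w]
  | 1 => [:: baaab ((n - 3) %/ 2) ((n - 3) %/ 2)]
  | 2 => let w1 := baaab ((n - 6) %/ 2) (n %/ 2) in
         let w2 := baaab ((n - 2) %/ 2) ((n - 4) %/ 2) in
         [:: w1; w2; rev w1; rev w2]
  | _ => let w := baaab ((n - 1) %/ 2) ((n - 5) %/ 2) in
         [:: baaab ((n - 3) %/ 2) ((n - 3) %/ 2); w; rev w]
  end.

(* The words with three a's that attain the minimum outside the family above.
   They have lengths 4, 6 and 7:
   abaa, aaba; abbbaa, aabbba, ababab, bababa; bababab. *)
Definition sporadic_words : seq word :=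
  [:: [:: La; Lb; La; La];
      [:: La; La; Lb; La];
      [:: La; Lb; Lb; Lb; La; La];
      [:: La; La; Lb; Lb; Lb; La];
      [:: La; Lb; La; Lb; La; Lb];
      [:: Lb; La; Lb; La; Lb; La];
      [:: Lb; La; Lb; La; Lb; La; Lb]].

(* Main.v *)
Require Import Defs.
From mathcomp Require Import all_boot.
From mathcomp Require Import zify.

(** A word with three a's is determined by the lengths of its four runs of
b's: w = b^p a b^q a b^r a b^s. An abelian square contains an even number of
a's, so inside w it contains none or two of them. Those without a's are the
words b^(2k) that fit in the longest run, floor (M / 2) of them for
M = max (p, q, r, s). Those with two a's are words b^i a b^m a b^j; the
middle of the square must separate the two a's, which is possible exactly when
i + m + j is even and |i - j| <= m; and the word occurs in w when m = q, i <= p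
and j <= r, or m = r, i <= q and j <= s. Hence the number of abelian squares is
exactly floor (M / 2) plus the number of such triples (m, i, j)
([num_abelian_squares_of_gaps]).

Put N = p + q + r + s, so that the bound floor ((n + 2) / 4) is
floor ((N + 1) / 4) + 1. If q = r = 0, the only square with two a's is aa, and
the count floor (max (p, s) / 2) + 1 attains the bound when p and s are nearly
equal, in a sense that depends on N mod 4; this gives the extremal words.
Otherwise the bound is exceeded, with seven exceptions. Indeed M >= N / 4
already provides floor (M / 2), about N / 8, and the triples with |i - j| <= 1
provide at least min (p, r) + min (q, s) more when q and r differ, and at least
the larger of these two minima when q = r. With the few extra triples of
[triples_equal_gaps] in the latter case, such linear estimates force p, s <= 1
and q, r <= 3 as soon as the bound is not exceeded ([few_squares_small_gaps]),
and the remaining 64 words are evaluated with the exact formula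
([nonadjacent_bound]). *)

(** * Words described by their runs of b's *)

(** The word b^g a b^(h1) a b^(h2) ... for l = [:: h1; h2; ...]. The first run
is a separate argument because the list of runs of a word is never empty. *)
Fixpoint of_gaps (g : nat) (l : seq nat) : word :=
  nseq g Lb ++ if l is h :: l' then La :: of_gaps h l' else [::].

Lemma of_gaps_ex (w : word) :
  exists g l, w = of_gaps g l /\ size l = num_a w.
Proof.
elim: w => [|[] w [g [l [-> sl]]]]; first by exists 0, [::].
- by exists 0, (g :: l); rewrite /= sl.
- by exists g.+1, l; split; [case: l {sl} | rewrite sl].
Qed.

Lemma num_a_of_gaps g l : num_a (of_gaps g l) = size l.
Proof.
elim: l g => [|h l IHl] g; rewrite /num_a /= count_cat count_nseq //=.
by rewrite mul0n -[in RHS](IHl h).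
Qed.

Lemma num_a_cat u v : num_a (u ++ v) = num_a u + num_a v.
Proof. exact: count_cat. Qed.

Lemma size_of_gaps g l : size (of_gaps g l) = g + sumn l + size l.
Proof.
elim: l g => [|h l IHl] g; rewrite /= size_cat size_nseq /=; first by lia.
by rewrite IHl; lia.
Qed.

(** The positions of the a's determine all the runs, so the encoding is a
bijection with all words. *)
Lemma of_gaps_inj g l g' l' :
  of_gaps g l = of_gaps g' l' -> g = g' /\ l = l'.
Proof.
elim: l g g' l' => [|h l IHl] g g' [|h' l'].
- by rewrite /= !cats0 => /(congr1 size); rewrite !size_nseq.
- by move/(congr1 num_a); rewrite !num_a_of_gaps.
- by move/(congr1 num_a); rewrite !num_a_of_gaps.
- elim: g g' => [|g IHg] [|g'] //=; first by case=> /IHl[-> ->].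
  by case=> /(IHg g')[-> ->].
Qed.

Lemma cat_nseq_of_gaps k g l : nseq k Lb ++ of_gaps g l = of_gaps (k + g) l.
Proof. by elim: k => //= k ->; case: l. Qed.

Lemma cat_of_gaps_cons g h l (v : word) :
  of_gaps g (h :: l) ++ v = nseq g Lb ++ La :: (of_gaps h l ++ v).
Proof. by rewrite /= -catA. Qed.

Lemma of_gaps0 g : of_gaps g [::] = nseq g Lb.
Proof. exact: cats0. Qed.

Lemma prefix_nseq_of_gaps k g l : prefix (nseq k Lb) (of_gaps g l) = (k <= g).
Proof.
elim: k g => [|k IHk] [|g]; rewrite ?prefix0s //; first by case: l {IHk}.
by rewrite ltnS -IHk; case: l {IHk}.
Qed.

Lemma infix_nseq_of_gaps k g l :
  infix (nseq k Lb) (of_gaps g l) = has (leq k) (g :: l).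
Proof.
elim: l g => [|h l IHl].
  elim=> [|g IHg]; first by case: k.
  have -> : of_gaps g.+1 [::] = Lb :: of_gaps g [::] by [].
  rewrite infix_consl -[Lb :: _]/(of_gaps g.+1 [::]).
  by rewrite prefix_nseq_of_gaps IHg /= !orbF; lia.
elim=> [|g IHg].
  have -> : of_gaps 0 (h :: l) = La :: of_gaps h l by [].
  rewrite infix_consl -[La :: _]/(of_gaps 0 (h :: l)).
  by rewrite prefix_nseq_of_gaps IHl.
have -> : of_gaps g.+1 (h :: l) = Lb :: of_gaps g (h :: l) by [].
rewrite infix_consl -[Lb :: _]/(of_gaps g.+1 (h :: l)).
rewrite prefix_nseq_of_gaps IHg [in LHS]/= [in RHS]/= orbA.
by congr (_ || _); lia.
Qed.

(* Case analyses on the list of runs must keep the encoding folded, so that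
   injectivity still applies after simplification. *)
Arguments of_gaps : simpl never.

(** * Which words are abelian squares and where they occur *)

Lemma abelian_square_nseq n :
  abelian_square (nseq n Lb) = (0 < n) && ~~ odd n.
Proof.
apply/abelian_squareP/andP.
  case=> u [v [e suv u0 _]]; have := congr1 size e.
  by rewrite size_nseq size_cat; lia.
case=> n0 no; exists (nseq n./2 Lb), (nseq n./2 Lb).
by rewrite -nseqD !size_nseq; split=> //; [congr nseq|]; lia.
Qed.

(** The triangle condition |i - j| <= m together with the parity of the total
length. *)
Definition balanced (m i j : nat) : bool :=
  [&& ~~ odd (m + i + j), i <= m + j & j <= m + i].

(** Each half contains one a, so the middle of the word lies in the run b^m.
It splits b^m into b^c and b^d with i + c = d + j, and such c, d >= 0 with
c + d = m exist exactly under the balance condition. *)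
Lemma abelian_square_two_a m i j :
  abelian_square (of_gaps i [:: m; j]) = balanced m i j.
Proof.
apply/abelian_squareP/idP.
  case=> u [v [e suv _ puv]].
  have [c [lu [uE slu]]] := of_gaps_ex u.
  have [d [lv [vE slv]]] := of_gaps_ex v.
  have nuv : num_a u = num_a v by case: puv.
  have := congr1 num_a e.
  rewrite num_a_of_gaps num_a_cat /= => n2.
  case: lu uE slu => [|c' [|? ?]] uE slu; move: slu; rewrite /=; try lia.
  case: lv vE slv => [|d' [|? ?]] vE slv _; move: slv; rewrite /=; try lia.
  move=> _; move: e suv.
  rewrite uE vE cat_of_gaps_cons of_gaps0 cat_nseq_of_gaps.
  rewrite -[nseq c Lb ++ _]/(of_gaps c [:: c' + d; d']) !size_of_gaps /=.
  by case/of_gaps_inj=> -> [-> ->]; rewrite /balanced; lia.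
case/and3P=> ev le1 le2.
(* The number of b's in each half. *)
set h := (m + i + j)./2.
exists (of_gaps i [:: h - i]), (of_gaps (h - j) [:: j]).
rewrite cat_of_gaps_cons of_gaps0 cat_nseq_of_gaps !size_of_gaps /=.
rewrite -[nseq i Lb ++ _]/(of_gaps i [:: h - i + (h - j); j]).
split; try (rewrite /h; lia).
  by congr of_gaps; congr [:: _; _]; rewrite /h; lia.
have num_b_of_gaps g l : num_b (of_gaps g l) = g + sumn l.
  have := size_of_gaps g l; have := num_a_of_gaps g l.
  rewrite -(count_predC (pred1 La)) /num_a => ->.
  suff -> : num_b (of_gaps g l) = count (predC (pred1 La)) (of_gaps g l) by lia.
  by apply: eq_count; case.
rewrite /parikh !num_a_of_gaps !num_b_of_gaps /=.
by congr pair; rewrite /h; lia.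
Qed.

(** An occurrence of two a's covers consecutive a's: the third a lies either
after the factor, or before it. *)
Lemma infix_two_a m i j p q r s :
  infix (of_gaps i [:: m; j]) (of_gaps p [:: q; r; s]) =
  [&& m == q, i <= p & j <= r] || [&& m == r, i <= q & j <= s].
Proof.
apply/infixP/idP; last first.
  case/orP=> /and3P[/eqP-> le1 le2].
    exists (nseq (p - i) Lb), (of_gaps (r - j) [:: s]).
    rewrite !cat_of_gaps_cons of_gaps0 cat_nseq_of_gaps.
    rewrite -[nseq i Lb ++ _]/(of_gaps i [:: q; j + (r - j); s]).
    by rewrite cat_nseq_of_gaps subnK // subnKC.
  exists (of_gaps p [:: q - i]), (of_gaps (s - j) [::]).
  rewrite !cat_of_gaps_cons (of_gaps0 j) (of_gaps0 (q - i)) cat_nseq_of_gaps.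
  rewrite -[nseq i Lb ++ _]/(of_gaps i [:: r; j + (s - j)]).
  rewrite cat_nseq_of_gaps -[RHS]/(of_gaps p [:: _; _; _]).
  by rewrite subnK // subnKC.
case=> y [z e].
have [c [ly [yE sly]]] := of_gaps_ex y.
have [d [lz [zE slz]]] := of_gaps_ex z.
have := congr1 num_a e.
rewrite num_a_of_gaps (num_a_cat y) (num_a_cat _ z) num_a_of_gaps.
rewrite -sly -slz {sly slz} /= => n3.
(* The part y before the factor has no a, or it has the first one. *)
case: ly yE n3 => [|c' [|? ?]] yE n3; last by exfalso; move: n3 => /=; lia.
  case: lz zE n3 => [|d' [|? ?]] zE n3; try by exfalso; move: n3 => /=; lia.
  move: e; rewrite yE zE !cat_of_gaps_cons (of_gaps0 c) (of_gaps0 j).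
  rewrite cat_nseq_of_gaps -[nseq i Lb ++ _]/(of_gaps i [:: m; j + d; d']).
  rewrite cat_nseq_of_gaps => /of_gaps_inj[-> [-> -> _]].
  by rewrite eqxx !leq_addl leq_addr.
case: lz zE n3 => [|? ?] zE n3; last by exfalso; move: n3 => /=; lia.
move: e; rewrite yE zE !cat_of_gaps_cons (of_gaps0 j) (of_gaps0 c').
rewrite cat_nseq_of_gaps.
rewrite -[nseq i Lb ++ _]/(of_gaps i [:: m; j + d]) cat_nseq_of_gaps.
rewrite -[nseq c Lb ++ _]/(of_gaps c [:: c' + i; m; j + d]).
by case/of_gaps_inj=> _ [-> -> ->]; rewrite eqxx !leq_addl leq_addr orbT.
Qed.

(** * The exact number of abelian squares *)

(** The squares b^i a b^m a b^j around a fixed pair of consecutive a's at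
distance m, with P and Q letters b available on the two sides. *)
Definition pair_triples (m P Q : nat) : seq (nat * nat * nat) :=
  [seq t <- [seq (m, i, j) | i <- iota 0 P.+1, j <- iota 0 Q.+1]
     | balanced t.1.1 t.1.2 t.2].

Lemma mem_pair_triples m P Q m' i j :
  ((m', i, j) \in pair_triples m P Q) =
  [&& m' == m, i <= P, j <= Q & balanced m i j].
Proof.
rewrite mem_filter; apply/andP/and4P.
  case=> bal /allpairsP[[i' j'] [hi hj [? ? ?]]]; subst.
  by move: hi hj; rewrite !mem_iota !add0n !ltnS !leq0n.
case=> /eqP-> hi hj bal; split=> //.
by apply/allpairsP; exists (i, j); rewrite !mem_iota !add0n !ltnS.
Qed.

(** Duplicates occur when q = r: the same word may then be found around both
pairs of consecutive a's. *)
Definition triples (p q r s : nat) : seq (nat * nat * nat) :=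
  undup (pair_triples q p r ++ pair_triples r q s).

Lemma mem_triples p q r s m i j :
  ((m, i, j) \in triples p q r s) =
  balanced m i j &&
    ([&& m == q, i <= p & j <= r] || [&& m == r, i <= q & j <= s]).
Proof.
rewrite mem_undup mem_cat !mem_pair_triples andb_orr.
congr orb; case: (m =P _) => [->|_] /=; rewrite ?andbF //;
  by rewrite [in RHS]andbC -!andbA.
Qed.

Lemma card_bseq_set (T : finType) n (P : pred (seq T)) (l : seq (seq T)) :
    uniq l -> P =i l -> (forall x, x \in l -> size x <= n) ->
  #|[set x : n.-bseq T | P x]| = size l.
Proof.
move=> ul Pl sl; rewrite cardE -(size_map val); apply/perm_size/uniq_perm => //.
  by rewrite (map_inj_uniq val_inj) enum_uniq.
move=> x; apply/mapP/idP => [[y]|lx].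
  by rewrite mem_enum inE => Py ->; rewrite -Pl.
by exists (Bseq (sl x lx)); rewrite // mem_enum inE /= -[P x]/(x \in P) Pl.
Qed.

Definition maxgap (p q r s : nat) : nat := maxn (maxn p q) (maxn r s).

(** Factors are sorted by their number of a's; one and three a's are excluded
by parity, and the two remaining classes are enumerated by [l0] and [l2]. *)
Lemma num_abelian_squares_of_gaps p q r s :
  num_abelian_squares (of_gaps p [:: q; r; s]) =
  (maxgap p q r s)./2 + size (triples p q r s).
Proof.
set w := of_gaps _ _; set M := maxgap _ _ _ _.
pose l0 := [seq nseq k.*2 Lb | k <- iota 1 M./2].
pose l2 := [seq of_gaps t.1.2 [:: t.1.1; t.2] | t <- triples p q r s].
have ul : uniq (l0 ++ l2).
  rewrite cat_uniq; apply/and3P; split.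
  - rewrite map_inj_uniq ?iota_uniq // => k k' /(congr1 size).
    by rewrite !size_nseq; lia.
  - apply/hasPn=> x /mapP[t _ ->]; apply/mapP=> -[k _].
    by rewrite -of_gaps0 => /of_gaps_inj[].
  - rewrite map_inj_uniq ?undup_uniq // => [[[m i] j] [[m' i'] j']] /=.
    by case/of_gaps_inj=> -> [-> ->].
have -> : M./2 + size (triples p q r s) = size (l0 ++ l2).
  by rewrite size_cat !size_map size_iota.
pose P x := infix x w && abelian_square x.
have Pl : P =i l0 ++ l2.
  move=> x; rewrite mem_cat -topredE /= /P.
  have [g [l [-> sl]]] := of_gaps_ex x.
  case: l {sl} => [|m [|j [|n l]]].
  - have -> : (of_gaps g [::] \in l2) = false.
      by apply/mapP=> -[t _ /of_gaps_inj[]].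
    rewrite orbF of_gaps0 infix_nseq_of_gaps abelian_square_nseq /=.
    apply/idP/mapP.
      move=> h; exists g./2; last by congr nseq; lia.
      by rewrite mem_iota /M /maxgap; lia.
    case=> k; rewrite mem_iota => hk /(congr1 size); rewrite !size_nseq => ->.
    by move: hk; rewrite /M /maxgap; lia.
  - have -> : abelian_square (of_gaps g [:: m]) = false.
      apply/abelian_squareP=> -[u [v [/(congr1 num_a)]]].
      by rewrite num_a_of_gaps num_a_cat /= => ? _ _ []; lia.
    rewrite andbF; apply/esym/norP; split; apply/mapP=> -[t _].
      by rewrite -of_gaps0 => /of_gaps_inj[].
    by case/of_gaps_inj.
  - have -> : (of_gaps g [:: m; j] \in l0) = false.
      by apply/mapP=> -[t _]; rewrite -of_gaps0 => /of_gaps_inj[].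
    rewrite abelian_square_two_a infix_two_a andbC -mem_triples.
    apply/idP/mapP => [h|[[[m' i'] j'] h]]; first by exists (m, g, j).
    by case/of_gaps_inj=> -> [-> ->].
  - have -> : (of_gaps g [:: m, j, n & l] \in l0) = false.
      by apply/mapP=> -[t _]; rewrite -of_gaps0 => /of_gaps_inj[].
    have -> : (of_gaps g [:: m, j, n & l] \in l2) = false.
      by apply/mapP=> -[t _ /of_gaps_inj[]].
    apply/negP=> /andP[/infixP[y [z /(congr1 num_a)]]].
    rewrite num_a_of_gaps (num_a_cat y) (num_a_cat _ z) num_a_of_gaps /=.
    move=> e.
    case/abelian_squareP=> u [v [/(congr1 num_a)]].
    by rewrite num_a_of_gaps num_a_cat /= => ? _ _ []; lia.
apply: (card_bseq_set _ _ P _ ul Pl) => x; rewrite -Pl => /andP[xw _].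
exact: size_infix.
Qed.

(** * Lower bounds on the squares with two a's *)

(** The triples closest to the diagonal i = j that the parity of m allows. They
satisfy |i - j| <= m for every m of that parity, and their number is linear in
P and Q. *)
Definition diagonal_list (m P Q : nat) : seq (nat * nat * nat) :=
  if odd m then
    [seq (m, i, i.+1) | i <- iota 0 (minn P.+1 Q)] ++
    [seq (m, i.+1, i) | i <- iota 0 (minn P Q.+1)]
  else [seq (m, i, i) | i <- iota 0 (minn P Q).+1].

Definition diagonal_count (m P Q : nat) : nat :=
  if odd m then minn P.+1 Q + minn P Q.+1 else (minn P Q).+1.

Lemma size_diagonal_list m P Q :
  size (diagonal_list m P Q) = diagonal_count m P Q.
Proof.
rewrite /diagonal_list /diagonal_count.
by case: ifP => _; rewrite ?size_cat !size_map !size_iota.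
Qed.

Lemma uniq_diagonal_list m P Q : uniq (diagonal_list m P Q).
Proof.
rewrite /diagonal_list; case: ifP => _.
  rewrite cat_uniq !map_inj_uniq ?iota_uniq ?andbT //=; try by move=> i i' [].
  by apply/hasPn=> x /mapP[i _ ->]; apply/mapP=> -[i' _ []]; lia.
by rewrite map_inj_uniq ?iota_uniq // => i i' [].
Qed.

Lemma mem_diagonal_list m P Q t : t \in diagonal_list m P Q ->
  [/\ t.1.1 = m, t.1.2 <= P, t.2 <= Q & balanced m t.1.2 t.2].
Proof.
rewrite /diagonal_list; case: ifP => om; last first.
  by case/mapP=> i; rewrite mem_iota => hi -> /=; rewrite /balanced; split; lia.
rewrite mem_cat => /orP[] /mapP[i]; rewrite mem_iota => hi -> /=;
  by rewrite /balanced; split=> //; lia.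
Qed.

Lemma diagonal_count_leq p q r s :
  maxn (diagonal_count q p r) (diagonal_count r q s) <= size (triples p q r s).
Proof.
rewrite geq_max -!size_diagonal_list; apply/andP.
split; apply: uniq_leq_size (uniq_diagonal_list _ _ _) _ => -[[m i] j];
  move=> /mem_diagonal_list[/= -> h1 h2 h3];
  by rewrite mem_triples h1 h2 h3 eqxx ?orbT.
Qed.

Lemma diagonal_count_add_leq p q r s : q != r ->
  diagonal_count q p r + diagonal_count r q s <= size (triples p q r s).
Proof.
move=> qr; rewrite -!size_diagonal_list -size_cat; apply: uniq_leq_size.
  rewrite cat_uniq !uniq_diagonal_list andbT /=; apply/hasPn=> t.
  move=> /mem_diagonal_list[tr _ _ _].
  apply/negP=> /mem_diagonal_list[tq _ _ _].
  by rewrite -tq tr eqxx in qr.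
move=> [[m i] j]; rewrite mem_cat mem_triples.
by case/orP=> /mem_diagonal_list[/= -> -> -> ->]; rewrite eqxx ?orbT.
Qed.

(** When the two inner runs agree, the diagonal triples around the two pairs may
coincide. If moreover the outer runs are empty, the diagonal estimates give
only 1, which is too little. These few triples near i = j = 0 exist whatever p
and s are, because each of them fits on at least one of the two sides. *)
Lemma triples_equal_gaps p m s : 0 < m ->
  (if odd m then 2 else 3) <= size (triples p m m s).
Proof.
move=> m0; pose l := if odd m then [:: (m, 0, 1); (m, 1, 0)]
                     else [:: (m, 0, 0); (m, 0, 2); (m, 2, 0)].
have -> : (if odd m then 2 else 3) = size l by rewrite /l; case: ifP.
apply: uniq_leq_size.
  by rewrite /l; case: ifP => _; rewrite /= !inE !xpair_eqE !eqxx.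
move=> [[m' i] j]; rewrite /l mem_triples /balanced.
by case: ifP => om; rewrite !inE => h; move: h; rewrite !xpair_eqE; lia.
Qed.

(** The inner runs are not both empty, so the squares with two a's grow at
least linearly in the smaller runs. The estimates are linear in p, q, r, s once
floor (M / 2) is replaced by an H with p, q, r, s <= 2 H + 1; what is left is
linear arithmetic, in the cases q = r and q <> r. *)
Lemma few_squares_small_gaps p q r s :
    (q, r) != (0, 0) ->
    (maxgap p q r s)./2 + size (triples p q r s) <
      (p + q + r + s + 1) %/ 4 + 2 ->
  [/\ p <= 1, q <= 3, r <= 3 & s <= 1].
Proof.
rewrite xpair_eqE => qr.
set T := size _; set H := _./2; set B := _ %/ 4 => few.
have [pH qH rH sH] :
    [/\ p <= H.*2.+1, q <= H.*2.+1, r <= H.*2.+1 & s <= H.*2.+1].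
  by rewrite /H /maxgap; split; lia.
have B4 : 4 * B <= p + q + r + s + 1 by rewrite /B; lia.
have := diagonal_count_leq p q r s; rewrite -/T geq_max => /andP[d1 d2].
clearbody H B.
have [eqr|nqr] := eqVneq q r; last first.
  have := diagonal_count_add_leq p q r s nqr; rewrite -/T => {d1 d2}.
  clearbody T; rewrite /diagonal_count.
  case: ifP => oq; case: ifP => odr ds; split; lia.
subst r; have q0 : 0 < q by lia.
have := triples_equal_gaps p q s q0; rewrite -/T.
clearbody T; move: d1 d2; rewrite /diagonal_count.
case: ifP => oq d1 d2 d3; split; lia.
Qed.

(** * Words attaining the bound *)

Definition sporadic_gaps : seq (nat * nat * nat * nat) :=
  [:: (0, 1, 0, 0); (0, 0, 1, 0); (0, 3, 0, 0); (0, 0, 3, 0);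
      (0, 1, 1, 1); (1, 1, 1, 0); (1, 1, 1, 1)].

(** Around adjacent a's balance forces i = j, and one side has no room, so aa is
the only square with two a's. *)
Lemma size_triples_adjacent p s : size (triples p 0 0 s) = 1.
Proof.
apply: (@perm_size _ _ [:: (0, 0, 0)]); apply: uniq_perm => //.
  exact: undup_uniq.
by move=> [[m i] j]; rewrite mem_triples inE !xpair_eqE /balanced; lia.
Qed.

(** Outside the box p, s <= 1 and q, r <= 3 the bound is exceeded; inside it
the exact formula is computed. *)
Lemma nonadjacent_bound p q r s : (q, r) != (0, 0) ->
  let B := (p + q + r + s + 1) %/ 4 + 1 in
  let T := (maxgap p q r s)./2 + size (triples p q r s) in
  B <= T /\ (T == B) = ((p, q, r, s) \in sporadic_gaps).
Proof.
move=> qr B T.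
have [/and4P[hp hq hr hs]|big] := boolP [&& p <= 1, q <= 3, r <= 3 & s <= 1].
  pose ok p q r s := let B := (p + q + r + s + 1) %/ 4 + 1 in
    let T := (maxgap p q r s)./2 + size (triples p q r s) in
    ((q, r) != (0, 0)) ==>
      (B <= T) && ((T == B) == ((p, q, r, s) \in sporadic_gaps)).
  have: all (fun p => all (fun q => all (fun r => all (ok p q r)
    (iota 0 2)) (iota 0 4)) (iota 0 4)) (iota 0 2) by vm_compute.
  move/allP/(_ p); rewrite mem_iota => /(_ hp).
  move/allP/(_ q); rewrite mem_iota => /(_ hq).
  move/allP/(_ r); rewrite mem_iota => /(_ hr).
  move/allP/(_ s); rewrite mem_iota => /(_ hs).
  by rewrite /ok qr => /andP[? /eqP].
have many : B < T.
  rewrite ltnNge; apply: contra big => few.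
  apply/and4P; apply: few_squares_small_gaps qr _.
  by rewrite -/T; move: few; rewrite /B; lia.
split; first exact: ltnW.
rewrite gtn_eqF //; apply/esym/negP; apply/negP; apply: contra big.
by rewrite !inE !xpair_eqE; lia.
Qed.

Lemma minimal_gaps p q r s :
  let B := (p + q + r + s + 1) %/ 4 + 1 in
  let T := num_abelian_squares (of_gaps p [:: q; r; s]) in
  B <= T /\
  (T == B) = [&& q == 0, r == 0 & (maxn p s)./2 == (p + s + 1) %/ 4]
             || ((p, q, r, s) \in sporadic_gaps).
Proof.
rewrite num_abelian_squares_of_gaps => B T.
have [[q0 r0]|qr] := eqVneq (q, r) (0, 0).
  rewrite /T /B q0 r0 size_triples_adjacent /maxgap !inE !xpair_eqE.
  by split; lia.
have [le ->] := nonadjacent_bound p q r s qr; split=> //.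
by move: qr; rewrite xpair_eqE; case: eqP => //= _ /negPf->.
Qed.

Lemma baaabE i j : baaab i j = of_gaps i [:: 0; 0; j].
Proof. by rewrite /of_gaps /baaab /= cats0. Qed.

Lemma rev_baaab i j : rev (baaab i j) = baaab j i.
Proof. by rewrite /baaab !rev_cat !rev_nseq catA. Qed.

Lemma eq_of_gaps g l g' l' :
  (of_gaps g l == of_gaps g' l') = (g == g') && (l == l').
Proof.
by apply/eqP/andP => [/of_gaps_inj[-> ->] //|[/eqP-> /eqP->]].
Qed.

(** The conditions on n mod 4 say that the longer outer run has the least
possible value of floor (max (p, s) / 2) when p + s = n - 3. *)
Lemma mem_extremal_words p q r s n : n = p + q + r + s + 3 ->
  (of_gaps p [:: q; r; s] \in extremal_words n) =
  [&& q == 0, r == 0 & (maxn p s)./2 == (p + s + 1) %/ 4].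
Proof.
move=> nE; rewrite /extremal_words.
case e: (n %% 4) => [|[|[|k]]];
  rewrite !inE ?rev_baaab !baaabE !eq_of_gaps !eqseq_cons eqxx !andbT;
  (have [q0|_] := eqVneq q 0; last by rewrite /= !andbF);
  (have [r0|_] := eqVneq r 0; last by rewrite /= !andbF);
  subst q r; rewrite /= ?orbA.
all: have ps : p + s + 3 = n by lia.
(* Writing n = 4 t + c turns every quotient into an affine function of t. *)
- have [t nt] : exists t, n = t.*2.*2 + 4 by exists (n %/ 4).-1; lia.
  have -> : (n - 4) %/ 2 = t.*2 by lia.
  have -> : (n - 2) %/ 2 = t.*2.+1 by lia.
  have -> : (p + s + 1) %/ 4 = t by lia.
  have {nt e nE}ps : p + s = t.*2.*2.+1 by lia.
  by case: leqP => ?; apply/idP/idP=> h; lia.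
- have [t nt] : exists t, n = t.*2.*2 + 5 by exists (n %/ 4).-1; lia.
  have -> : (n - 3) %/ 2 = t.*2.+1 by lia.
  have -> : (p + s + 1) %/ 4 = t by lia.
  have {nt e nE}ps : p + s = t.*2.*2.+2 by lia.
  by case: leqP => ?; apply/idP/idP=> h; lia.
- have [t nt] : exists t, n = t.*2.*2 + 6 by exists (n %/ 4).-1; lia.
  have -> : (n - 6) %/ 2 = t.*2 by lia.
  have -> : n %/ 2 = t.*2 + 3 by lia.
  have -> : (n - 2) %/ 2 = t.*2.+2 by lia.
  have -> : (n - 4) %/ 2 = t.*2.+1 by lia.
  have -> : (p + s + 1) %/ 4 = t.+1 by lia.
  have {nt e nE}ps : p + s = t.*2.*2 + 3 by lia.
  by case: leqP => ?; apply/idP/idP=> h; lia.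
- have [t nt] : exists t, n = t.*2.*2 + 3 by exists (n %/ 4); lia.
  have -> : (n - 3) %/ 2 = t.*2 by lia.
  have -> : (n - 1) %/ 2 = t.*2.+1 by lia.
  (* For t = 0 the subtraction is truncated, and the word is too long. *)
  have -> : (n - 5) %/ 2 = t.*2.-1 by lia.
  have -> : (p + s + 1) %/ 4 = t by lia.
  have {nt e nE}ps : p + s = t.*2.*2 by lia.
  by case: leqP => ?; apply/idP/idP=> h; lia.
Qed.

Lemma mem_sporadic_words p q r s :
  (of_gaps p [:: q; r; s] \in sporadic_words) =
  ((p, q, r, s) \in sporadic_gaps).
Proof.
pose f t : word := let: (p, q, r, s) := t in of_gaps p [:: q; r; s].
have -> : sporadic_words = map f sporadic_gaps by [].
rewrite (mem_map _ _ (p, q, r, s)) // => -[[[? ?] ?] ?] [[[? ?] ?] ?].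
by case/of_gaps_inj=> -> [-> -> ->].
Qed.

Lemma three_a_gaps (w : word) : num_a w = 3 ->
  exists p q r s, w = of_gaps p [:: q; r; s].
Proof.
have [p [l [-> <-]]] := of_gaps_ex w.
by case: l => [|q [|r [|s []]]] // _; exists p, q, r, s.
Qed.

Theorem theorem8 :
  (* (a) the three forms of the bound, the lower bound, and its attainment *)
  [/\ (forall n : nat, 3 <= n ->
         (uphalf (n - 3))./2 + 1 = (uphalf (n + 1))./2
         /\ (uphalf (n + 1))./2 = (n + 2) %/ 4),
      (forall (n : nat) (w : word), size w = n -> num_a w = 3 ->
         (n + 2) %/ 4 <= num_abelian_squares w)
    & (forall n : nat, 3 <= n ->
         let w := baaab (n - 3)./2 (uphalf (n - 3)) in
         [/\ size w = n, num_a w = 3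
           & num_abelian_squares w = (n + 2) %/ 4])]
  (* (b) the full set of words attaining the bound *)
  /\ (forall (n : nat) (w : word), size w = n -> num_a w = 3 ->
        n \notin [:: 4; 6; 7] ->
        (num_abelian_squares w = (n + 2) %/ 4 <-> w \in extremal_words n))
  (* the lengths at which there are further words attaining the bound *)
  /\ (forall (n : nat) (w : word), size w = n -> num_a w = 3 ->
        n \in [:: 4; 6; 7] ->
        (num_abelian_squares w = (n + 2) %/ 4 <->
         w \in extremal_words n ++ sporadic_words)).
Proof.
have gaps n w : size w = n -> num_a w = 3 -> exists p q r s,
    [/\ w = of_gaps p [:: q; r; s], n = p + q + r + s + 3
      & (n + 2) %/ 4 = (p + q + r + s + 1) %/ 4 + 1].
  move=> <- /three_a_gaps[p [q [r [s ->]]]]; exists p, q, r, s.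
  by rewrite size_of_gaps /=; split=> //; lia.
split; first split.
- by move=> n n3; lia.
- move=> n w sw aw; have [p [q [r [s [-> _ ->]]]]] := gaps n w sw aw.
  by have [] := minimal_gaps p q r s.
- move=> n n3 w; rewrite /w baaabE size_of_gaps num_a_of_gaps.
  rewrite num_abelian_squares_of_gaps size_triples_adjacent /maxgap /=.
  by split=> //; lia.
split=> n w sw aw hn; have [p [q [r [s [wE nE ->]]]]] := gaps n w sw aw;
  have [_ minE] := minimal_gaps p q r s; rewrite wE.
- rewrite (mem_extremal_words _ _ _ _ _ nE); split=> [/eqP|ext].
    rewrite minE => /orP[//|spo]; move: spo hn.
    by rewrite nE !inE !xpair_eqE; lia.
  by apply/eqP; rewrite minE ext.
- rewrite mem_cat (mem_extremal_words _ _ _ _ _ nE) mem_sporadic_words -minE.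
  by split=> /eqP.
Qed.
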